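(* There exists a finite colouring of $\mathbb{N}^{(2)}$ such that there do not exist natural numbers $x_1<x_2<\cdots$ for which all the pairs $(x_{k_1}-x_{k_2}+x_{k_3}-\cdots+x_{k_t},\ x_{k_{t+1}})$, where $t$ is odd and $k_1<k_2<\cdots<k_{t+1}$, have the same colour.
   Context: $\mathbb{N}^{(2)}$ denotes the set of pairs $(a,b)$ of natural numbers with $a<b$ (the edge set of the complete graph on $\mathbb{N}$). Note that for $x_1<x_2<\cdots$, $t$ odd and $k_1<\cdots<k_{t+1}$, one has $0<x_{k_1}-x_{k_2}+\cdots+x_{k_t}<x_{k_{t+1}}$, so these are indeed elements of $\mathbb{N}^{(2)}$. *)

(* Defs.v *)
From mathcomp Require Import all_boot all_order all_algebra.
From mathcomp Require Import zify.

Set Implicit Arguments.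
Unset Strict Implicit.
Unset Printing Implicit Defensive.

Import Order.TTheory GRing.Theory Num.Theory.
Local Open Scope ring_scope.

(** The natural numbers start at 1; for x_1 = 0 the alternating sum with t = 1
    would not be positive. *)
Definition edge : Type := {p : nat * nat | (0 < p.1 < p.2)%N}.

(** [t] stands for t and [k] for k_1 < ... < k_(t+1), stored as
    [k 0], ..., [k t]; the sign of x_(k_(i+1)) is therefore (-1)^i.
    The sum is taken in [int], so no subtraction is truncated. *)
Definition alternating_sum (x : nat -> nat) (t : nat) (k : 'I_t.+1 -> nat) : int :=
  \sum_(i < t) (-1) ^+ i * (x (k (widen_ord (leqnSn t) i)))%:Z.

Definition is_alternating_pair (x : nat -> nat) (e : edge) : Prop :=
  exists (t : nat) (k : 'I_t.+1 -> nat),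
    [/\ odd t,
        forall i j : 'I_t.+1, (i < j)%N -> (k i < k j)%N,
        (val e).1%:Z = alternating_sum x k
      & (val e).2 = x (k ord_max)].

Definition monochromatic (C : Type) (c : edge -> C) (P : edge -> Prop) : Prop :=
  exists a : C, forall e : edge, P e -> c e = a.

Lemma odd_alternating_sum_bounds (y : nat -> nat) (s : nat) :
  (0 < y 0)%N ->
  (forall i, (i < s.*2)%N -> (y i < y i.+1)%N) ->
  0 < \sum_(i < s.*2.+1) (-1) ^+ i * (y i)%:Z <= (y s.*2)%:Z.
Proof.
move=> y0; elim: s => [|s IHs] yI.
  by rewrite big_ord1 /= expr0 mul1r lexx andbT; lia.
have {IHs} := IHs (fun i lt_i => yI i ltac:(lia)).
have := yI s.*2 ltac:(lia); have := yI s.*2.+1 ltac:(lia).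
rewrite doubleS 2![in X in _ -> _ -> _ -> X]big_ord_recr /=.
set S := \sum_(i < _) _.
rewrite -signr_odd /= odd_double -(signr_odd _ s.*2.+2) /= odd_double.
by rewrite expr1 expr0 mulN1r mul1r; lia.
Qed.

(** Every choice of odd [t] and [k] yields an element of [edge], so quantifying
    over the edges in [is_alternating_pair] loses none of the pairs. *)
Lemma alternating_pair_edge (x : nat -> nat) (t : nat) (k : 'I_t.+1 -> nat) :
  (forall n, (0 < x n)%N) ->
  (forall m n, (m < n)%N -> (x m < x n)%N) ->
  odd t ->
  (forall i j : 'I_t.+1, (i < j)%N -> (k i < k j)%N) ->
  exists e : edge,
    (val e).1%:Z = alternating_sum x k /\ (val e).2 = x (k ord_max).
Proof.
move=> x0 xI odd_t kI.
have [s def_t] : exists s, t = s.*2.+1 by exists t./2; lia.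
pose y i := x (k (inord i)).
have yI i : (i < t)%N -> (y i < y i.+1)%N.
  by move=> lt_i; apply/xI/kI; rewrite !inordK //; lia.
have sumE : alternating_sum x k = \sum_(i < s.*2.+1) (-1) ^+ i * (y i)%:Z.
  rewrite -def_t; apply: eq_bigr => i _; congr (_ * (x (k _))%:Z).
  by apply: val_inj; rewrite /= inordK //; have := ltn_ord i; lia.
have yI' i : (i < s.*2)%N -> (y i < y i.+1)%N by move=> ?; apply: yI; lia.
have := odd_alternating_sum_bounds (x0 _) yI'.
rewrite -sumE => bnd.
have lty : (y s.*2 < x (k ord_max))%N.
  by apply/xI/kI; rewrite inordK /=; lia.
have pE : (0 < (`|alternating_sum x k|%N, x (k ord_max)).1
             < (`|alternating_sum x k|%N, x (k ord_max)).2)%N.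
  by rewrite /=; move: bnd lty; set S := alternating_sum x k; lia.
exists (exist (fun p : nat * nat => is_true (0 < p.1 < p.2)%N) _ pE).
split=> /=; last by [].
by move: bnd; set S := alternating_sum x k; lia.
Qed.

(* Main.v *)
From Stdlib Require Import Classical.
Require Import Defs.
From mathcomp Require Import all_boot all_order all_algebra.
From mathcomp Require Import zify ring.

Set Implicit Arguments.
Unset Strict Implicit.
Unset Printing Implicit Defensive.

(** Read the binary digits of a pair (a, b) from the lowest one upwards, call a
    position i active when exactly one of "b has digit 1 at i" and
    "a mod 2^i > b mod 2^i" holds, and let w(a) be the parity of the number of
    blocks of ones among the digits of a at active positions.  The point is that
    a and b - a have the same active positions (modulo powers of 2) and opposite
    digits there.  Thin out x and fix b = x_4, so that x_1, x_2, x_3 agree with b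
    on ever longer initial segments.  Along a = x_1 - x_2 + x_3 the digits
    follow x_1, then b - x_2, then x_3; between these stretches the active digits
    are 0 after x_1 and 1 before x_3.  The blocks of x_2 and of b - x_2
    alternate, whence w(a) = w(x_1) + w(x_2) + w(x_3) + 1, which is incompatible
    with w being constant.

    This breaks down when the x_n accumulate 2-adically at a natural number al,
    as b then has no ones to separate the stretches.  In that case one counts the
    blocks of ones of a above the lowest digit at which a and b differ, and the
    same identity holds.  The colouring records both parities. *)

(** The state consists of the borrow bit "a > b so far", the digit of [a] at the
    last active position, and the parity of the number of changes from 0 to 1
    among the active digits of [a]. *)
Definition step (st : bool * bool * bool) (x y : bool) : bool * bool * bool :=
  let: (c, s, p) := st in
  (if x == y then c else x,
   if y (+) c then x else s,
   p (+) [&& y (+) c, x & ~~ s]).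

Fixpoint run (n : nat) st (a b : nat) :=
  if n is n'.+1 then run n' (step st (odd a) (odd b)) a./2 b./2 else st.

(** * Elementary behaviour of the digit automaton *)

Lemma runD m n st a b :
  run (m + n) st a b = run n (run m st a b) (a %/ 2 ^ m) (b %/ 2 ^ m).
Proof.
elim: m st a b => [|m IHm] st a b; first by rewrite expn0 !divn1.
by rewrite addSn /= IHm expnS !divnMA !divn2.
Qed.

Lemma bit0_half_mod n a :
  odd (a %% 2 ^ n.+1) = odd a /\ (a %% 2 ^ n.+1)./2 = a./2 %% 2 ^ n.
Proof.
have K0 : 0 < 2 ^ n by rewrite expn_gt0.
have K1 : 0 < 2 ^ n.+1 by rewrite expn_gt0.
have := divn_eq a (2 ^ n.+1); have := ltn_pmod a K1.
move: K1 (a %/ _) (a %% _) => _ q r; rewrite expnS => lt_r ->.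
split; first lia.
have -> : (q * (2 * 2 ^ n) + r)./2 = q * 2 ^ n + r./2 by lia.
rewrite modnMDl modn_small //; lia.
Qed.

Lemma run_mod n st a b : run n st (a %% 2 ^ n) (b %% 2 ^ n) = run n st a b.
Proof.
elim: n st a b => [|n IHn] st a b //=.
have [-> ->] := bit0_half_mod n a; have [-> ->] := bit0_half_mod n b.
exact: IHn.
Qed.

Lemma run_parity n c s p a b :
  (run n (c, s, p) a b).2 = p (+) (run n (c, s, false) a b).2.
Proof.
elim: n c s p a b => [|n IHn] c s p a b /=; first by rewrite addbF.
by rewrite IHn [in RHS]IHn addbA.
Qed.

Lemma run0_parity n st b : (run n st 0 b).2 = st.2.
Proof.
elim: n st b => [|n IHn] [[c s] p] b //=.
by rewrite IHn /= andbF addbF.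
Qed.

Lemma run_parity_stable m n st a b :
  a < 2 ^ m -> m <= n -> (run n st a b).2 = (run m st a b).2.
Proof.
by move=> lt_a /subnKC <-; rewrite runD divn_small // run0_parity.
Qed.

Lemma run_refl n p a : run n (false, true, p) a a = (false, true, p).
Proof.
elim: n p a => [|n IHn] p a //=.
by case: (odd a); rewrite /= ?addbF; exact: IHn.
Qed.

(** Equal digits never raise the borrow, so the active positions are the ones of [a] itself: a
    single block, opened at the lowest one. *)
Lemma run_refl_neq0 n p a :
  0 < a %% 2 ^ n -> run n (false, false, p) a a = (false, true, ~~ p).
Proof.
elim: n p a => [|n IHn] p a; first by rewrite modn1.
have [] := bit0_half_mod n a; move: (_ %% _) => r odd_r half_r r_gt0 /=.
case odd_a: (odd a) => /=; first by rewrite addbT run_refl.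
by rewrite addbF IHn // -half_r; lia.
Qed.

Lemma run0_borrow n st b : 0 < b %% 2 ^ n -> (run n st 0 b).1.1 = false.
Proof.
have carry0 m s p d : (run m (false, s, p) 0 d).1.1 = false.
  elim: m s p d => [|m IHm] s p d //=.
  by case: (odd d); exact: IHm.
elim: n st b => [|n IHn] [[c s] p] b; first by rewrite modn1.
have [] := bit0_half_mod n b; move: (_ %% _) => r odd_r half_r r_gt0 /=.
case odd_b: (odd b) => /=; first exact: carry0.
by rewrite IHn // -half_r; lia.
Qed.

Lemma run0_last n s p b :
  0 < b %% 2 ^ n -> run n (false, s, p) 0 b = (false, false, p).
Proof.
have zero m d : run m (false, false, p) 0 d = (false, false, p).
  elim: m d => [|m IHm] d //=.
  by case: (odd d); rewrite /= addbF; exact: IHm.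
elim: n s b => [|n IHn] s b; first by rewrite modn1.
have [] := bit0_half_mod n b; move: (_ %% _) => r odd_r half_r r_gt0 /=.
case odd_b: (odd b) => /=; rewrite addbF; first exact: zero.
by rewrite IHn // -half_r; lia.
Qed.

(* While one run rises from 0 to 1, the complementary one falls; so the two
   parities together count all the changes of [s]. *)
Lemma run_compl n (c s p p' : bool) u a v :
  u + a + c = v %[mod 2 ^ n] ->
  run n (c, ~~ s, p') a v =
  let: (c1, s1, p1) := run n (c, s, p) u v in
  (c1, ~~ s1, p1 (+) s1 (+) (p (+) s (+) p')).
Proof.
elim: n c s p p' u a v => [|n IHn] c s p p' u a v.
  by move=> _ /=; congr (_, _); case: p s p' => [] [] [].
move=> eqv.
have [odd_l half_l] := bit0_half_mod n (u + a + c).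
have [odd_r half_r] := bit0_half_mod n v.
(* Hence [a] and [u] have opposite digits exactly where [odd v (+) c] holds, that is, at active
   positions. *)
have odd_a : odd a = odd v (+) (odd u (+) c).
  rewrite -odd_r -eqv odd_l !oddD oddb.
  by case: (odd u) (odd a) c {eqv odd_l half_l} => [] [] [].
(* [c'] is at once the carry of the addition and the next borrow of both runs. *)
pose c' := if odd u == odd v then c else odd u.
have eqv' : u./2 + a./2 + c' = v./2 %[mod 2 ^ n].
  rewrite -half_r -eqv half_l; congr (_ %% _).
  rewrite /c'; clear -odd_a; move: odd_a.
  case odd_u: (odd u); case odd_v: (odd v) => /=; case: c => /= odd_a; lia.
pose s' := if odd v (+) c then odd u else s.
rewrite /= odd_a.
have -> : (if odd v (+) (odd u (+) c) == odd v then c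
           else odd v (+) (odd u (+) c)) = c'.
  by rewrite /c'; clear; case: (odd u) (odd v) c => [] [] [].
have -> : (if odd v (+) c then odd v (+) (odd u (+) c) else ~~ s) = ~~ s'.
  by rewrite /s'; clear; case: (odd u) (odd v) c => [] [] [].
rewrite (IHn c' s' (p (+) [&& odd v (+) c, odd u & ~~ s]) _ _ _ _ eqv').
rewrite -/c' -/s'; case: (run n _ _ _) => [[c1 s1] p1]; congr (_, _, _ (+) _).
by rewrite /s'; clear; case: (odd u) (odd v) c s p p' => [] [] [] [] [] [].
Qed.

(** The interval [P, m) contains two ones of [b], and [x] has no digit there: the
    first one clears the borrow, the second one is then active and resets the
    last active digit. *)
Definition settled x b m :=
  exists P Q, [/\ P <= Q, Q <= m, x < 2 ^ P, 2 ^ P <= b %% 2 ^ Q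
                & 2 ^ Q <= b %% 2 ^ m].

(** As [a < 2 ^ a], [a] steps read every digit of [a]. For [c] true and [b = 0] all positions are
    active, which gives the plain number of blocks of ones of [a] modulo 2. *)
Definition block_parity c a b := (run a (c, false, false) a b).2.

Lemma block_parityE c n a b : a < 2 ^ n ->
  (run n (c, false, false) a b).2 = block_parity c a b.
Proof.
move=> lt_a; have lt_a' := ltn_expl a (isT : 1 < 2).
rewrite -(run_parity_stable _ _ lt_a (leq_maxl n a)).
exact: run_parity_stable lt_a' (leq_maxr n a).
Qed.

(** * Alternating sums of settled terms *)

Lemma run0_settled P Q m st b : P <= Q -> Q <= m ->
   2 ^ P <= b %% 2 ^ Q -> 2 ^ Q <= b %% 2 ^ m ->
   run (m - P) st 0 (b %/ 2 ^ P) = (false, false, st.2).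
Proof.
move=> lePQ leQm bQ bm.
rewrite -(subnKC (leq_sub2r P leQm)) runD div0n -divnMA -expnD subnKC //.
rewrite subnBA // subnK; last exact: leq_trans leQm.
have lo : 0 < (b %/ 2 ^ P) %% 2 ^ (Q - P).
  by rewrite modn_divl mulnC -expnD subnKC // divn_gt0 ?expn_gt0.
have hi : 0 < (b %/ 2 ^ Q) %% 2 ^ (m - Q).
  by rewrite modn_divl mulnC -expnD subnKC // divn_gt0 ?expn_gt0.
have := run0_borrow st lo; have := run0_parity (Q - P) st (b %/ 2 ^ P).
by case: (run (Q - P) _ _ _) => [[c s] p] /= <- ->; exact: run0_last.
Qed.

Lemma run_settled m x b : settled x b m ->
  run m (false, false, false) x b = (false, false, block_parity false x b).
Proof.
move=> [P [Q [lePQ leQm ltx bQ bm]]].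
rewrite -(block_parityE _ b ltx) -(subnKC (leq_trans lePQ leQm)) runD.
rewrite (divn_small ltx); exact: (run0_settled _ lePQ leQm bQ bm).
Qed.

(** While [x] agrees with [b] it shows one block, still open at [k]; this is the starting state. *)
Lemma run_settled_shift k m x b : settled x b m -> k <= m ->
  0 < b %% 2 ^ k -> x = b %[mod 2 ^ k] ->
  run (m - k) (false, true, true) (x %/ 2 ^ k) (b %/ 2 ^ k)
    = (false, false, block_parity false x b).
Proof.
move=> /run_settled <- lekm b0 eqxb.
rewrite -[in RHS](subnKC lekm) runD -(run_mod k _ x b) eqxb run_mod.
by rewrite run_refl_neq0.
Qed.

Lemma block_parity_alternating x1 x2 x3 b m k :
  m <= k -> x1 < 2 ^ m -> settled x1 b m -> settled x2 b k ->
  x2 = b %[mod 2 ^ m] -> x3 = b %[mod 2 ^ k] -> x2 < x3 ->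
  block_parity false (x1 + x3 - x2) b =
  ~~ (block_parity false x1 b (+) block_parity false x2 b
      (+) block_parity false x3 b).
Proof.
move=> lemk lt1 st1 st2 eq2 eq3 lt23.
have K0 n : 0 < 2 ^ n by rewrite expn_gt0.
have bm0 : x1 < b %% 2 ^ m.
  have [P [Q [lePQ leQm ltx1 bQ bm]]] := st1.
  apply: leq_trans bm; apply: (leq_trans ltx1); exact: leq_pexp2l.
have bk0 : x2 < b %% 2 ^ k.
  have [P [Q [lePQ leQm ltx1 bQ bk]]] := st2.
  apply: leq_trans bk; apply: (leq_trans ltx1); exact: leq_pexp2l.
have eq3m : x3 = b %[mod 2 ^ m].
  have dv : 2 ^ m %| 2 ^ k by rewrite dvdn_exp2l.
  by rewrite -(modn_dvdm x3 dv) eq3 modn_dvdm.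
set a := x1 + x3 - x2.
pose u := x2 %/ 2 ^ m; pose t := x3 %/ 2 ^ m; pose v := b %/ 2 ^ m.
have aE : a = (t - u) * 2 ^ m + x1.
  have e2 := divn_eq x2 (2 ^ m); have e3 := divn_eq x3 (2 ^ m).
  rewrite /a mulnBl -/u -/t in e2 e3 *.
  have le_ut : u * 2 ^ m <= t * 2 ^ m.
    by rewrite leq_mul2r leq_div2r ?orbT // ltnW.
  move: e2 e3; rewrite eq2 eq3m; lia.
pose j := k - m.
have lowa : run m (false, false, false) a b
    = (false, false, block_parity false x1 b).
  rewrite -run_mod aE modnMDl modn_small //.
  rewrite -[X in run m _ X _](modn_small lt1) run_mod.
  exact: run_settled.
have diva : a %/ 2 ^ m = t - u.
  by rewrite aE divnMDl // divn_small // addn0.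
have le_ut : u <= t by exact/leq_div2r/ltnW.
have tv : t = v %[mod 2 ^ j].
  rewrite /t /v !modn_divl /j mulnC -expnD subnKC //; congr (_ %/ _).
  exact: eq3.
have midk : run k (false, false, false) a b
    = (false, true, block_parity false x1 b (+) block_parity false x2 b).
  rewrite -(subnKC lemk) runD lowa diva -/j.
  have eqv : u + (t - u) + false = v %[mod 2 ^ j] by rewrite addn0 subnKC.
  (* At [m] the last active digit is 0 for the sum and 1 for [x2], complementary as [run_compl]
     demands. *)
  rewrite -[false as s in (_, s, _)]/(~~ true) (run_compl true true _ eqv).
  rewrite /u /v run_settled_shift //; last exact: leq_ltn_trans bm0.
  by rewrite addbF /=; case: (block_parity _ x1 b) (block_parity _ x2 b) => [] [].
have modk : a %/ 2 ^ k = x3 %/ 2 ^ k.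
  rewrite -(subnKC lemk) expnD !divnMA diva -/t -/j.
  (* So subtracting [u] from [t] borrows nothing from the digits at [j] and above. *)
  have lt_ut : u < t %% 2 ^ j.
    rewrite tv /v /j modn_divl mulnC -expnD subnKC //.
    have dv : 2 ^ m %| 2 ^ k by rewrite dvdn_exp2l.
    move: bk0; rewrite {1}(divn_eq x2 (2 ^ m)) {1}(divn_eq (b %% 2 ^ k) (2 ^ m)).
    by rewrite modn_dvdm // eq2 ltn_add2r ltn_pmul2r.
  rewrite {1}(divn_eq t (2 ^ j)) -addnBA; last exact: ltnW.
  rewrite divnMDl // [X in _ + X]divn_small ?addn0 //.
  exact: leq_ltn_trans (leq_subr _ _) (ltn_pmod _ _).
(* Source of the negation: from [k] on, [x3] and the sum gain the same blocks, but [x3] arrives with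
   parity 1 from its initial block, the sum with the parities of [x1] and [x2]. *)
have run3 : run k (false, false, false) x3 b = (false, true, true).
  rewrite -run_mod eq3 run_mod run_refl_neq0 //; exact: leq_ltn_trans bk0.
have N3 : x3 < 2 ^ (k + (a + x3)).
  by apply: leq_ltn_trans (ltn_expl _ (isT : 1 < 2)); rewrite addnA leq_addl.
have Na : a < 2 ^ (k + (a + x3)).
  by apply: leq_ltn_trans (ltn_expl _ (isT : 1 < 2)); rewrite addnCA leq_addr.
rewrite -(block_parityE _ _ Na) -(block_parityE _ _ N3) !(runD k) modk midk run3.
rewrite run_parity [in RHS]run_parity.
case: (block_parity _ x1 b) (block_parity _ x2 b).
  by case=> //=; rewrite negbK.
by case=> //=; rewrite negbK.
Qed.

(** For [a < b], the digits of [a] strictly above the lowest one at which [a] and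
    [b] differ. *)
Definition high_bits (a b : nat) := a %/ 2 ^ (logn 2 (b - a)).+1.

(** * Alternating sums near a natural 2-adic limit *)

Lemma logn_expn_odd m y : odd y -> logn 2 (2 ^ m * y) = m.
Proof.
by move=> y_odd; rewrite mulnC logn_Gauss ?pfactorK // coprime2n.
Qed.

(** Here [b - al] is an even multiple of [2 ^ m], so the lowest differing digit is at [m], the
    bottom digit of [y]. *)
Lemma high_bitsE m al y b : al < 2 ^ m -> odd y -> al + 2 ^ m * y < b ->
  b = al %[mod 2 ^ m.+1] -> high_bits (al + 2 ^ m * y) b = y./2.
Proof.
move=> lt_al y_odd lt_b eq_b.
have [z bE] : exists z, b = al + 2 ^ m * z.*2.
  have lt_al' : al < 2 ^ m.+1 by rewrite expnS; lia.
  exists (b %/ 2 ^ m.+1); rewrite {1}(divn_eq b (2 ^ m.+1)) eq_b.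
  by rewrite modn_small // addnC mulnC -mul2n mulnA -expnSr.
have lt_yz : y < z.*2.
  by move: lt_b; rewrite bE ltn_add2l ltn_pmul2l ?expn_gt0.
rewrite /high_bits bE subnDl -mulnBr logn_expn_odd; last first.
  by rewrite oddB ?odd_double ?y_odd // ltnW.
rewrite expnSr divnMA divn2 addnC mulnC divnMDl ?expn_gt0 //.
by rewrite divn_small // addn0.
Qed.

(** Against 0 a borrow is never cleared; the extra top digit 0 closes the last block. *)
Lemma run_padded k z : z < 2 ^ k ->
  run k.+1 (true, false, false) z 0 = (true, false, block_parity true z 0).
Proof.
have borrow n s p a : (run n (true, s, p) a 0).1.1.
  by elim: n s p a => [|n IHn] s p a //=; case: (odd a); exact: IHn.
move=> lt_z; rewrite -(block_parityE _ _ lt_z) -addn1 runD divn_small // div0n.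
have := borrow k false false z; case: (run k _ _ _) => [[c s] p] /= ->.
by rewrite addbF.
Qed.

(** From the lowest digit up, the number reads: [z1] and a 0, then a 1, the complement of [z2] on
    [l.+1] digits, a 0, and [z3]. The middle stretch begins and ends with 1, so it has one block
    more than [z2]. *)
Lemma block_parity_alternating0 k l z1 z2 z3 : z1 < 2 ^ k -> z2 < 2 ^ l ->
  block_parity true ((2 ^ l.+2 * z3.*2.+1 - z2.*2.+1) * 2 ^ k.+1 + z1) 0
  = ~~ (block_parity true z1 0 (+) block_parity true z2 0
        (+) block_parity true z3 0).
Proof.
move=> lt1 lt2; set C := _ - _; set w := _ + z1.
have lt1' : z1 < 2 ^ k.+1 by rewrite expnS; lia.
have lt2' : z2 < 2 ^ l.+1 by rewrite expnS; lia.
pose D := 2 ^ l.+1 * z3.*2 + (2 ^ l.+1 - z2.+1).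
have CE : C = D.*2.+1.
  rewrite /C /D (expnS _ l.+1) mulnS -mulnA; clear -lt2'.
  by move: (2 ^ l.+1) (2 ^ l.+1 * _) lt2' => ? ?; lia.
have DE : D %/ 2 ^ l.+1 = z3.*2.
  rewrite /D mulnC divnMDl ?expn_gt0 // divn_small ?addn0 //.
  by rewrite ltn_subrL expn_gt0.
have eqD : z2 + D + true = 0 %[mod 2 ^ l.+1].
  have -> : z2 + D + true = z3.*2.+1 * 2 ^ l.+1.
    rewrite /D mulSn [_ * 2 ^ _]mulnC; clear -lt2'.
    by move: (2 ^ l.+1) (2 ^ l.+1 * _) lt2' => ? ?; lia.
  by rewrite modnMl mod0n.
have lt3 : z3 < 2 ^ (w + z3).
  by apply: leq_ltn_trans (ltn_expl _ (isT : 1 < 2)); rewrite leq_addl.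
have ltw : w < 2 ^ (k.+1 + (1 + (l.+1 + (1 + (w + z3))))).
  apply: leq_ltn_trans (ltn_expl _ (isT : 1 < 2)).
  by clearbody w; clear; lia.
have runw : run k.+1 (true, false, false) w 0
    = (true, false, block_parity true z1 0).
  by rewrite -run_mod mod0n modnMDl modn_small // run_padded.
have divw : w %/ 2 ^ k.+1 = C by rewrite divnMDl ?expn_gt0 // divn_small // addn0.
rewrite -(block_parityE _ _ ltw) runD div0n runw divw CE; clearbody w D.
have run_odd p : run 1 (true, false, p) D.*2.+1 0 = (true, true, ~~ p).
  by rewrite /= odd_double /= addbT.
have run_even p : run 1 (true, true, p) z3.*2 0 = (true, false, p).
  by rewrite /= odd_double /= addbF.
have divD : D.*2.+1 %/ 2 ^ 1 = D by rewrite expn1 divn2 /= uphalf_double.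
have divz : z3.*2 %/ 2 ^ 1 = z3 by rewrite expn1 divn2 doubleK.
rewrite runD run_odd divD div0n runD div0n.
rewrite -[true as s in (_, s, _)]/(~~ false) (run_compl false false _ eqD).
rewrite run_padded // DE runD run_even divz div0n.
rewrite run_parity (block_parityE _ _ lt3) !addbF addFb addbN addNb.
by rewrite [block_parity true z2 0 (+) _]addbC.
Qed.

(** The alternating sum is again [al] plus an odd multiple of [2 ^ m], so its high bits form the
    number treated in [block_parity_alternating0]. *)
Lemma high_bits_alternating al k l m z1 z2 z3 b :
  al < 2 ^ m -> z1 < 2 ^ k -> z2 < 2 ^ l ->
  let x1 := al + 2 ^ m * z1.*2.+1 in
  let x2 := al + 2 ^ (m + k.+2) * z2.*2.+1 in
  let x3 := al + 2 ^ (m + k.+2 + l.+2) * z3.*2.+1 in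
  x1 < x2 < x3 -> x3 < b -> b = al %[mod 2 ^ (m + k.+2 + l.+2).+1] ->
  block_parity true (high_bits (x1 + x3 - x2) b) 0 =
  ~~ (block_parity true (high_bits x1 b) 0
      (+) block_parity true (high_bits x2 b) 0
      (+) block_parity true (high_bits x3 b) 0).
Proof.
move=> lt_al lt1 lt2 x1 x2 x3 /andP[lt12 lt23] lt3b eqb.
have al_lt n : al < 2 ^ (m + n).
  by apply: leq_trans lt_al _; rewrite leq_pexp2l ?leq_addr.
have eqb' n : n <= m + k.+2 + l.+2 -> b = al %[mod 2 ^ n.+1].
  move=> le_n; have dv : 2 ^ n.+1 %| 2 ^ (m + k.+2 + l.+2).+1 by rewrite dvdn_exp2l.
  by rewrite -(modn_dvdm b dv) eqb modn_dvdm.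
have odd1 z : odd z.*2.+1 by rewrite /= odd_double.
have half1 z : z.*2.+1./2 = z by rewrite /= uphalf_double.
rewrite (high_bitsE (y := z1.*2.+1)) ?half1 //; last first.
- by apply: eqb'; rewrite -addnA leq_addr.
- exact: ltn_trans lt12 (ltn_trans lt23 lt3b).
rewrite (high_bitsE (y := z2.*2.+1)) ?half1 //; last first.
- by apply: eqb'; rewrite leq_addr.
- exact: ltn_trans lt23 lt3b.
rewrite (high_bitsE (y := z3.*2.+1)) ?half1 //; last by rewrite -addnA.
rewrite -(block_parity_alternating0 _ lt1 lt2).
set C := 2 ^ l.+2 * _ - _.
have aE : x1 + x3 - x2 = al + 2 ^ m * (C * 2 ^ k.+1 + z1).*2.+1.
  have CE : 2 ^ m * (C * 2 ^ k.+1).*2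
      = 2 ^ (m + k.+2 + l.+2) * z3.*2.+1 - 2 ^ (m + k.+2) * z2.*2.+1.
    rewrite -mul2n /C mulnBl !mulnBr !expnD (expnS _ k.+1).
    move: (2 ^ m) (2 ^ k.+1) (2 ^ l.+2) z3.*2.+1 z2.*2.+1 => M A B y3 y2.
    by congr (_ - _); ring.
  have -> : (C * 2 ^ k.+1 + z1).*2.+1 = (C * 2 ^ k.+1).*2 + z1.*2.+1 by lia.
  rewrite mulnDr CE; move: lt23; rewrite /x1 /x2 /x3; clear.
  by move: (_ * _) (2 ^ (m + k.+2) * _) (2 ^ m * _) => ? ? ?; lia.
rewrite aE high_bitsE ?half1 //.
- rewrite -aE; apply: ltn_trans lt3b.
  by move: lt12 lt23; clearbody x1 x2 x3; clear; lia.
- by apply: eqb'; rewrite -addnA leq_addr.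
Qed.

(** * Thinning out a sequence by residues *)

Definition infinite (S : nat -> Prop) := forall N, exists2 n, N <= n & S n.

Lemma infinite_pigeonhole (S : nat -> Prop) (f : nat -> nat) d :
  infinite S -> (forall n, S n -> f n < d) ->
  exists r, infinite (fun n => S n /\ f n = r).
Proof.
elim: d S => [|d IHd] S infS ltf.
  by have [n _ /ltf] := infS 0.
have [inf_d | fin_d] := classic (infinite (fun n => S n /\ f n = d)).
  by exists d.
have [N bndN] := not_all_ex_not _ _ fin_d.
have [| |r infr] := IHd (fun n => N <= n /\ S n).
- by move=> M; have [n] := infS (maxn M N); rewrite geq_max => /andP[]; exists n.
- move=> n [leNn Sn]; have := ltf n Sn; rewrite ltnS leq_eqVlt.
  by case/orP=> [/eqP fn_d | //]; case: bndN; exists n.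
- by exists r => M; have [n leMn [[_ Sn] fn]] := infr M; exists n.
Qed.

(** Provides a digit 1 in [[P, Q)] common to infinitely many terms: a residue [r] modulo [2 ^ P] is
    not a limit, so some finer residue differs from [r]. *)
Lemma infinite_residue_ge (x : nat -> nat) (S : nat -> Prop) P :
  (forall al, exists m, ~ infinite (fun n => x n = al %[mod 2 ^ m])) ->
  infinite S ->
  exists Q r (S' : nat -> Prop),
    [/\ P <= Q, 2 ^ P <= r, infinite S', forall n, S' n -> S n
      & forall n, S' n -> x n %% 2 ^ Q = r].
Proof.
move=> no_lim infS.
have [n _|r infr] := @infinite_pigeonhole _ (fun n => x n %% 2 ^ P) (2 ^ P) infS.
  by rewrite ltn_pmod ?expn_gt0.
have [m fin_m] := no_lim r; pose Q := maxn P m.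
have [n _|r' infr'] :=
  @infinite_pigeonhole _ (fun n => x n %% 2 ^ Q) (2 ^ Q) infr.
  by rewrite ltn_pmod ?expn_gt0.
have dvP : 2 ^ P %| 2 ^ Q by rewrite dvdn_exp2l ?leq_maxl.
have dvm : 2 ^ m %| 2 ^ Q by rewrite dvdn_exp2l ?leq_maxr.
exists Q, r', (fun n => (S n /\ x n %% 2 ^ P = r) /\ x n %% 2 ^ Q = r').
split=> [|||n [[]]|n []] //; first exact: leq_maxl.
rewrite leqNgt; apply/negP => lt_r'; case: fin_m => N.
have [n leNn [[_ xnr] xnr']] := infr' N; exists n => //.
have <- : r' = r by rewrite -xnr -(modn_dvdm (x n) dvP) xnr' modn_small.
by rewrite -xnr' modn_dvdm.
Qed.

Lemma odd_quotient al x M : al < x -> x = al %[mod 2 ^ M] ->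
  exists m z, M <= m /\ x = al + 2 ^ m * z.*2.+1.
Proof.
move=> lt_al /eqP; rewrite eqn_mod_dvd; last exact: ltnW.
move=> dvM; have d0 : 0 < x - al by rewrite subn_gt0.
have [y co_y xE] := pfactor_coprime (isT : prime 2) d0.
exists (logn 2 (x - al)), y./2; split; first by rewrite -pfactor_dvdn.
have -> : y./2.*2.+1 = y.
  by rewrite -[RHS]odd_double_half; move: co_y; rewrite coprime2n => ->.
by rewrite mulnC -xE subnKC // ltnW.
Qed.

(** * The colouring and the terms that defeat monochromaticity *)

Definition colour (p : nat * nat) : bool * bool :=
  (block_parity false p.1 p.2, block_parity true (high_bits p.1 p.2) 0).

Lemma colour_alternating (x : nat -> nat) :
  (forall n, 0 < x n) -> (forall m n, m < n -> x m < x n) ->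
  exists n1 n2 n3 n4, n1 < n2 < n3 /\ n3 < n4 /\
   let f n := colour (x n, x n4) in
   let a := colour (x n1 + x n3 - x n2, x n4) in
    a.1 = ~~ ((f n1).1 (+) (f n2).1 (+) (f n3).1) \/
    a.2 = ~~ ((f n1).2 (+) (f n2).2 (+) (f n3).2).
Proof.
move=> x0 xI.
have x_gt n : n < x n by elim: n => // n IHn; apply: leq_ltn_trans IHn (xI _ _ _).
have E0 n : n < 2 ^ n by exact: ltn_expl.
have [[al lim] | no_lim] := classic
    (exists al, forall m, infinite (fun n => x n = al %[mod 2 ^ m])).
- have get N M : al <= N -> exists n m z,
      [/\ N < n, M <= m & x n = al + 2 ^ m * z.*2.+1].
    move=> leN; have [n ltNn eqn] := lim M N.+1.
    have [|m [z [leMm xnE]]] := odd_quotient _ eqn.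
      exact: leq_ltn_trans leN (ltn_trans ltNn (x_gt n)).
    by exists n, m, z.
  have [n1 [m1 [z1 [alt1 lem1 x1E]]]] := get al al (leqnn _).
  have al1 := ltnW alt1.
  (* The bound [m1 + z1.+2] leaves room for all digits of [z1] and the padding below the leading
     difference of the next term; likewise for [z2]. *)
  have [n2 [m2 [z2 [lt12 lem2 x2E]]]] := get n1 (m1 + z1.+2) al1.
  have al2 := leq_trans al1 (ltnW lt12).
  have [n3 [m3 [z3 [lt23 lem3 x3E]]]] := get n2 (m2 + z2.+2) al2.
  have [n4 lt34 x4E] := lim m3.+1 n3.+1.
  exists n1, n2, n3, n4; split; first by rewrite lt12.
  split=> //=; right.
  move: lem2 lem3 => /subnKC m2E /subnKC m3E.
  pose k := z1 + (m2 - (m1 + z1.+2)); pose l := z2 + (m3 - (m2 + z2.+2)).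
  have {}m2E : m2 = m1 + k.+2 by rewrite -{1}m2E /k !addnS !addSn addnA.
  have {}m3E : m3 = m1 + k.+2 + l.+2.
    by rewrite -m2E -{1}m3E /l !addnS !addSn addnA.
  rewrite x1E x2E x3E m3E m2E.
  apply: high_bits_alternating.
  + by apply: leq_trans (E0 _) _; rewrite leq_pexp2l.
  + by apply: leq_trans (E0 _) _; rewrite leq_pexp2l ?leq_addr.
  + by apply: leq_trans (E0 _) _; rewrite leq_pexp2l ?leq_addr.
  + by rewrite -m3E -m2E -x1E -x2E -x3E !xI.
  + by rewrite -m3E -x3E xI.
  + by rewrite -m3E.
have {}no_lim al : exists m, ~ infinite (fun n => x n = al %[mod 2 ^ m]).
  by apply: not_all_ex_not => lim; apply: no_lim; exists al.
have infT : infinite (fun _ => True) by move=> N; exists N.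
(* Two rounds give every remaining term a one in [[x 0, Q1)] and another in [[Q1, m)], so [x 0] is
   settled. *)
have [Q1 [r1 [S1 [lePQ1 ler1 inf1 _ S1r]]]] :=
  infinite_residue_ge (x 0) no_lim infT.
have [m [s1 [T1 [leQm les1 infT1 T1S T1r]]]] := infinite_residue_ge Q1 no_lim inf1.
have [n2 lt2 T1n2] := infT1 1.
(* The [maxn] secures both [m <= k] and room for [x n2]. *)
have [Q2 [r2 [S2 [lePQ2 ler2 inf2 S2T S2r]]]] :=
  infinite_residue_ge (maxn m (x n2)) no_lim infT1.
have [k [s2 [T2 [leQk les2 infT2 T2S T2r]]]] := infinite_residue_ge Q2 no_lim inf2.
have [n3 lt23 T2n3] := infT2 n2.+1.
have [n4 lt34 T2n4] := infT2 n3.+1.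
exists 0, n2, n3, n4; rewrite lt2 lt23 lt34; do 2!split=> //; left => /=.
have S2n4 := T2S _ T2n4; have T1n4 := S2T _ S2n4; have S1n4 := T1S _ T1n4.
have lemk : m <= k by rewrite (leq_trans _ leQk) // (leq_trans (leq_maxl _ _) lePQ2).
apply: (block_parity_alternating lemk); rewrite ?(T1r _ T1n4) ?(T2r _ T2n4) //;
  try exact: xI.
- apply: leq_trans (E0 _) _; rewrite leq_pexp2l //; exact: leq_trans leQm.
- by exists (x 0), Q1; rewrite (S1r _ S1n4) (T1r _ T1n4).
- exists (maxn m (x n2)), Q2; rewrite (S2r _ S2n4) (T2r _ T2n4).
  by split=> //; apply: leq_trans (E0 _) _; rewrite leq_pexp2l // leq_maxr.
- exact: T1r.
- exact: T2r.
Qed.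

(** * Pairs with [t = 1] and [t = 3], and the conclusion *)

Lemma pair1_alternating (x : nat -> nat) i j (e : edge) :
  i < j -> val e = (x i, x j) -> is_alternating_pair x e.
Proof.
move=> lt_ij eE; exists 1, (fun h : 'I_2 => nth 0 [:: i; j] h); split=> //.
- by case=> [[|[|?]]] ? [[|[|?]]].
- by rewrite eE /alternating_sum big_ord1 /= GRing.expr0 GRing.mul1r.
- by rewrite eE.
Qed.

Lemma pair3_alternating (x : nat -> nat) i j k l (e : edge) :
  i < j -> j < k -> k < l -> x j <= x k -> val e = (x i + x k - x j, x l) ->
  is_alternating_pair x e.
Proof.
move=> lt_ij lt_jk lt_kl le_x eE.
exists 3, (fun h : 'I_4 => nth 0 [:: i; j; k; l] h); split=> //.
- by move=> [[|[|[|[|?]]]] ?] [[|[|[|[|?]]]] ?] //= _; lia.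
- rewrite eE /alternating_sum !big_ord_recl big_ord0 /= /bump /=.
  by rewrite !(GRing.exprS, GRing.expr0); lia.
- by rewrite eE.
Qed.

Lemma edge_val (a b : nat) : 0 < a < b -> exists e : edge, val e = (a, b).
Proof.
by move=> lt_ab; exists (exist (fun p => is_true (0 < p.1 < p.2)) (a, b) lt_ab).
Qed.

Theorem theorem2 :
  exists (r : nat) (c : edge -> 'I_r),
    ~ exists x : nat -> nat,
        [/\ forall n : nat, (0 < x n)%N,
            forall m n : nat, (m < n)%N -> (x m < x n)%N
          & monochromatic c (is_alternating_pair x)].
Proof.
exists #|{: bool * bool}|, (fun e => enum_rank (colour (val e))).
move=> [x [x0 xI [a mono]]].
have [i [j [k [l [/andP[lt_ij lt_jk] [lt_kl]]]]]] := colour_alternating x0 xI.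
have col1 h : h < l -> colour (x h, x l) = enum_val a.
  move=> lt_hl; have [|e eE] := @edge_val (x h) (x l); first by rewrite x0 xI.
  by rewrite -eE -(mono e) ?enum_rankK //; exact: pair1_alternating lt_hl eE.
have lt1 := xI _ _ lt_ij; have lt2 := xI _ _ lt_jk; have lt3 := xI _ _ lt_kl.
have [|e eE] := @edge_val (x i + x k - x j) (x l).
  by have := x0 i; move: lt1 lt2 lt3; clear; lia.
have alt_e := pair3_alternating lt_ij lt_jk lt_kl (ltnW lt2) eE.
have col3 : colour (x i + x k - x j, x l) = enum_val a.
  by rewrite -eE -(mono e alt_e) enum_rankK.
cbv zeta; rewrite col3 !col1 ?(ltn_trans lt_jk) //; last first.
  exact: ltn_trans lt_ij (ltn_trans lt_jk lt_kl).
(* With one common colour, either identity says that a bit equals the negation of its threefold sum,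
   hence its own negation. *)
by case: (enum_val a) => [] [] [] [].
Qed.
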